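(* Let $T$ be a locally finite complex of ($\mathbb Z^t$-graded) free $E$-modules. The following statements are equivalent: 1. Every strand of $T$ is exact. 2. Every proper region complex of $T$ is exact. 3. Every corner complex $T_{\Rsh c}$, $c\in\mathbb Z^t$, is exact. 4. The corner complexes $T_{\Rsh c}$ are exact for every sufficiently large $c\in\mathbb Z^t$. 5. The proper region complexes $T_c(I,\emptyset,\emptyset)$ are exact for every sufficiently large $c\in\mathbb Z^t$ (and every $I\subsetneq\{1,\dots,t\}$).
   Context: Setting: $K$ is a field, $V_1,\dots,V_t$ are $K$-vector spaces with $\dim V_i=n_i+1$, and $E=\bigwedge(\bigoplus_iV_i)$ is $\mathbb Z^t$-graded with $V_i$ in degree $(0,\dots,-1,\dots,0)$ ($-1$ in place $i$). $E$-modules are graded right modules with degree-preserving maps, $N(a)_b=N_{a+b}$, and $\omega_E=\operatorname{Hom}_K(E,K)$, free of rank 1 with socle in degree $0$. $\mathbb Z^t$ has the termwise partial order. Complexes are cohomological, $C[k]^d=C^{k+d}$; the mapping cone $[\phi]$ of $\phi:A\to B$ sits in $0\to B\to[\phi]\to A[1]\to0$. A complex of $E$-modules is locally finite if for each multidegree the sum over all terms of the graded components in that multidegree is finite dimensional. Write the terms of $T$ as $T^d=\bigoplus_{a\in\mathbb Z^t}B^d_a\otimes_K\omega_E(-a)$ with $B_a^d$ vector spaces in degree $0$. For $c\in\mathbb Z^t$ and pairwise disjoint subsets $I,J,L\subset\{1,\dots,t\}$, the region complex $T_c(I,J,L)$ is the subquotient complex of $T$ with terms $$T_c(I,J,L)^d=\bigoplus_{a}B_a^d\otimes\omega_E(-a),$$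 the sum over $a\in\mathbb Z^t$ with $a_i<c_i$ for $i\in I$, $a_i=c_i$ for $i\in J$, $a_i\ge c_i$ for $i\in L$. It is a quadrant complex if $I\cup J\cup L=\{1,\dots,t\}$, and a proper region complex otherwise. A strand of $T$ is a region complex $T_c(\emptyset,J,\emptyset)$ with $J\subsetneq\{1,\dots,t\}$ (so $T$ itself is the strand with $J=\emptyset$). Corner complexes: put $qT_{c,I}=T_c(I,\emptyset,\{1,\dots,t\}\setminus I)$, $T_{<c}=qT_{c,\{1,\dots,t\}}$, $T_{\ge c}=qT_{c,\emptyset}$. For $k=1,\dots,t$ the (termwise split) exact sequence $$0\to qT_{c,\{1,\dots,k-1\}}\to T_c(\{1,\dots,k-1\},\emptyset,\{k+1,\dots,t\})\to qT_{c,\{1,\dots,k\}}\to0$$ yields, via the components of the differential of the middle complex, a morphism of complexes $qT_{c,\{1,\dots,k\}}[-1]\to qT_{c,\{1,\dots,k-1\}}$. The corner map $\varphi_c:T_{<c}[-t]\to T_{\ge c}$ is the composition of these $t$ (suitably shifted) morphisms, and the corner complex $T_{\Rsh c}$ is the mapping cone of $\varphi_c$. ''For every sufficiently large $c$'' means: there is $c_0\in\mathbb Z^t$ such that the assertion holds for all $c\ge c_0$. *)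

(* Defs.v *)
From HB Require Import structures.
From mathcomp Require Import all_boot all_order all_algebra.
Set Implicit Arguments.
Unset Strict Implicit.
Unset Printing Implicit Defensive.
Import Order.TTheory GRing.Theory Num.Theory.
Local Open Scope ring_scope.

Definition Zt (t : nat) : Type := {ffun 'I_t -> int}.
HB.instance Definition _ t := GRing.Zmodule.on (Zt t).

Definition led t (a b : Zt t) : bool := [forall i, a i <= b i].

(* A basis of the direct sum of the V_i: V_i is the span of the (i, j),
   with j < n i + 1. *)
Definition var t (n : 'I_t -> nat) : finType := {i : 'I_t & 'I_(n i).+1}.

(* The degree of a monomial is [- wt S], since V_i sits in degree -1. *)
Definition wt t (n : 'I_t -> nat) (S : {set var n}) : Zt t :=
  [ffun i => #|[set x in S | tag x == i]|%:Z].

(* An element of E = \bigwedge (\bigoplus_i V_i) is given by its coordinates on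
   the monomials e_S = x_1 \wedge ... \wedge x_r, S = {x_1 < ... < x_r}. *)
Definition ext (K : fieldType) t (n : 'I_t -> nat) : Type :=
  {ffun {set var n} -> K^o}.

Section Exterior.
Variables (K : fieldType) (t : nat) (n : 'I_t -> nat).
Local Notation X := (var n).
Local Notation E := (ext K n).
Implicit Types (A B C S U : {set X}) (f g h : E).

HB.instance Definition _ := GRing.Lmodule.on E.

Definition emon S : E := [ffun U => (U == S)%:R].

Definition inversions A B : nat :=
  \sum_(x in A) \sum_(y in B) (enum_rank y < enum_rank x)%N.

Definition emonM A B : E :=
  if [disjoint A & B] then (-1) ^+ inversions A B *: emon (A :|: B) else 0.

Definition emul f g : E := \sum_A \sum_B (f A * g B) *: emonM A B.

Lemma ext_sum f : f = \sum_A f A *: emon A.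
Proof.
apply/ffunP => U; rewrite sum_ffunE (bigD1 U) //= big1 => [|A neAU].
  by rewrite !ffunE eqxx addr0 [_ *: _]mulr1.
by rewrite !ffunE eq_sym (negPf neAU) [_ *: _]mulr0.
Qed.

Lemma emul_linl g : linear (emul^~ g).
Proof.
move=> k f1 f2; rewrite /emul scaler_sumr -big_split /=; apply: eq_bigr => A _.
rewrite scaler_sumr -big_split /=; apply: eq_bigr => B _.
by rewrite !ffunE mulrDl scalerDl -[_ *: f1 A]/(_ * _) -mulrA scalerA.
Qed.

Lemma emul_linr f : linear (emul f).
Proof.
move=> k g1 g2; rewrite /emul scaler_sumr -big_split /=; apply: eq_bigr => A _.
rewrite scaler_sumr -big_split /=; apply: eq_bigr => B _.
by rewrite !ffunE mulrDr scalerDl -[_ *: g1 B]/(_ * _) mulrCA scalerA.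
Qed.

Lemma emulDl : left_distributive emul +%R.
Proof. by move=> f1 f2 g; have := emul_linl g 1 f1 f2; rewrite !scale1r. Qed.

Lemma emulDr : right_distributive emul +%R.
Proof. by move=> f g1 g2; have := emul_linr f 1 g1 g2; rewrite !scale1r. Qed.

Lemma emul0l f : emul 0 f = 0.
Proof. by apply: (addrI (emul 0 f)); rewrite -emulDl !addr0. Qed.

Lemma emul0r f : emul f 0 = 0.
Proof. by apply: (addrI (emul f 0)); rewrite -emulDr !addr0. Qed.

Lemma emulZl (k : K) f g : emul (k *: f) g = k *: emul f g.
Proof. by have := emul_linl g k f 0; rewrite emul0l !addr0. Qed.

Lemma emulZr (k : K) f g : emul f (k *: g) = k *: emul f g.
Proof. by have := emul_linr f k g 0; rewrite emul0r !addr0. Qed.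

Lemma emul_suml (F : {set X} -> E) g : emul (\sum_A F A) g = \sum_A emul (F A) g.
Proof. exact: (big_morph (emul^~ g) (fun x y => emulDl x y g) (emul0l g)). Qed.

Lemma emul_sumr f (F : {set X} -> E) : emul f (\sum_A F A) = \sum_A emul f (F A).
Proof. exact: (big_morph (emul f) (emulDr f) (emul0r f)). Qed.

Lemma emul_mon A B : emul (emon A) (emon B) = emonM A B.
Proof.
rewrite /emul (bigD1 A) //= (bigD1 B) //= !ffunE !eqxx mulr1 scale1r.
rewrite big1 => [|C neCB]; last by rewrite !ffunE (negPf neCB) mulr0 scale0r.
rewrite big1 => [|C neCA]; first by rewrite !addr0.
by rewrite big1 // => D _; rewrite !ffunE (negPf neCA) mul0r scale0r.
Qed.

Lemma inversionsUl A B C : [disjoint A & B] ->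
  inversions (A :|: B) C = (inversions A C + inversions B C)%N.
Proof.
move=> dAB; rewrite /inversions -(@bigU _ _ _ _ _ _ _ dAB) /=.
by apply: eq_bigl => x; rewrite !inE.
Qed.

Lemma inversionsUr A B C : [disjoint B & C] ->
  inversions A (B :|: C) = (inversions A B + inversions A C)%N.
Proof.
move=> dBC; rewrite /inversions -big_split /=.
apply: eq_bigr => x _; rewrite -(@bigU _ _ _ _ _ _ _ dBC) /=.
by apply: eq_bigl => y; rewrite !inE.
Qed.

Lemma emul_monA A B C :
  emul (emon A) (emul (emon B) (emon C)) = emul (emul (emon A) (emon B)) (emon C).
Proof.
rewrite !emul_mon /emonM.
have dU2 : [disjoint A & B :|: C] = [disjoint A & B] && [disjoint A & C].
  by rewrite -!setI_eq0 setIUr setU_eq0.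
have dU1 : [disjoint A :|: B & C] = [disjoint A & C] && [disjoint B & C].
  by rewrite -!setI_eq0 setIUl setU_eq0.
case dBC : [disjoint B & C]; case dAB : [disjoint A & B];
  rewrite ?emul0r ?emul0l //.
- rewrite emulZr emulZl !emul_mon /emonM dU1 dU2 dAB dBC andbT /=.
  case: ifP => _; last by rewrite !scaler0.
  rewrite !scalerA -!exprD inversionsUl // inversionsUr // setUA.
  by congr ((-1) ^+ _ *: _); rewrite addnC addnA.
- by rewrite emulZr emul_mon /emonM dU2 dAB /= scaler0.
- by rewrite emulZl emul_mon /emonM dU1 dBC andbF scaler0.
Qed.

Lemma emulA : associative emul.
Proof.
move=> f g h.
rewrite [f]ext_sum (emul_suml _ g) (emul_suml _ (emul g h)) (emul_suml _ h).
apply: eq_bigr => A _; rewrite !emulZl; congr (_ *: _).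
rewrite [g]ext_sum (emul_suml _ h) !(emul_sumr (emon A)) (emul_suml _ h).
apply: eq_bigr => B _; rewrite emulZl !emulZr emulZl; congr (_ *: _).
rewrite [h]ext_sum (emul_sumr (emon B)) (emul_sumr (emon A)).
rewrite (emul_sumr (emul _ _)); apply: eq_bigr => C _.
by rewrite !emulZr emul_monA.
Qed.

Lemma emonM0l A : emonM set0 A = emon A.
Proof.
by rewrite /emonM -setI_eq0 set0I eqxx set0U /inversions big_set0 expr0 scale1r.
Qed.

Lemma emonM0r A : emonM A set0 = emon A.
Proof.
rewrite /emonM -setI_eq0 setI0 eqxx setU0 /inversions big1 ?expr0 ?scale1r //.
by move=> x _; rewrite big_set0.
Qed.

Lemma emul1l : left_id (emon set0) emul.
Proof.
move=> f; rewrite {1}[f]ext_sum emul_sumr [RHS]ext_sum.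
by apply: eq_bigr => A _; rewrite emulZr emul_mon emonM0l.
Qed.

Lemma emul1r : right_id (emon set0) emul.
Proof.
move=> f; rewrite {1}[f]ext_sum emul_suml [RHS]ext_sum.
by apply: eq_bigr => A _; rewrite emulZl emul_mon emonM0r.
Qed.

Lemma emon0_neq0 : emon set0 != 0.
Proof.
by apply/eqP => /ffunP/(_ set0); rewrite !ffunE eqxx => /eqP; rewrite oner_eq0.
Qed.

HB.instance Definition _ := GRing.Zmodule_isNzRing.Build E
  emulA emul1l emul1r emulDl emulDr emon0_neq0.

Lemma ext_scaleAl (k : K) (f g : E) : k *: (f * g) = (k *: f) * g.
Proof. by symmetry; exact: emulZl. Qed.

HB.instance Definition _ := GRing.Lmodule_isLalgebra.Build K E ext_scaleAl.

Lemma ext_scaleAr (k : K) (f g : E) : k *: (f * g) = f * (k *: g).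
Proof. by symmetry; exact: emulZr. Qed.

HB.instance Definition _ := GRing.Lalgebra_isAlgebra.Build K E ext_scaleAr.

Definition ext_homog (s : Zt t) (f : E) : Prop :=
  forall S, f S != 0 -> s = - wt S.

End Exterior.

(* [act b c m e] is the component of degree c of the product m e of m, of degree
   b, by e: it only depends on the component of degree c - b of e. *)
Record gmod (K : fieldType) (t : nat) (n : 'I_t -> nat) := GMod {
  grade :> Zt t -> lmodType K;
  act : forall b c : Zt t, grade b -> ext K n -> grade c;
  act_linl : forall b c e, linear (fun m : grade b => act c m e);
  act_linr : forall b c (m : grade b), linear (@act b c m : ext K n -> grade c);
  act_homog : forall b c (m : grade b) s e,
    ext_homog s e -> s <> c - b -> act c m e = 0;
  act1 : forall b (m : grade b), act b m 1 = m;
  actM : forall b c d (m : grade b) e f,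
    ext_homog (c - b) e -> act d (act c m e) f = act d m (e * f)
}.
Arguments act {K t n} M {b} c m e : rename.

Record ghom (K : fieldType) (t : nat) (n : 'I_t -> nat) (M N : gmod K n) := GHom {
  hmap :> forall b : Zt t, {linear M b -> N b};
  hmap_act : forall (b c : Zt t) (m : M b) (e : ext K n),
    hmap c (act M c m e) = act N c (hmap b m) e
}.

Section GHom.
Variables (K : fieldType) (t : nat) (n : 'I_t -> nat).
Implicit Types M N P : gmod K n.

Lemma act0l M b c e : act M c (0 : M b) e = 0.
Proof.
have := act_linl (g := M) c e (-1) (0 : M b) 0.
by rewrite scaler0 addr0 scaleN1r addNr.
Qed.

Definition ghom_id M : ghom M M.
Proof. by exists (fun b => (idfun : {linear M b -> M b})). Defined.

Definition ghom_zero M N : ghom M N.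
Proof.
exists (fun b => (\0 : {linear M b -> N b})) => b c m e /=.
by rewrite act0l.
Defined.

Definition ghom_comp M N P (g : ghom N P) (f : ghom M N) : ghom M P.
Proof.
exists (fun b => (g b \o f b : {linear M b -> P b})) => b c m e /=.
by rewrite !hmap_act.
Defined.

Definition ghom_scale M N (k : K) (f : ghom M N) : ghom M N.
Proof.
exists (fun b => (k \*: f b : {linear M b -> N b})) => b c m e /=.
have := act_linl (g := N) c e k (f b m) 0.
by rewrite !addr0 act0l addr0 hmap_act => ->.
Defined.

End GHom.

Section DProd.
Variables (K : fieldType) (I : finType) (V : I -> lmodType K).

Definition dprod : Type := {dffun forall i, V i}.
HB.instance Definition _ := Choice.copy dprod {dffun forall i, V i}.

Implicit Types f g h : dprod.

Definition dprod_zero : dprod := [ffun i => 0 : V i].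
Definition dprod_opp f : dprod := [ffun i => - f i].
Definition dprod_add f g : dprod := [ffun i => f i + g i].
Definition dprod_scale (k : K) f : dprod := [ffun i => k *: f i].

Fact dprod_addA : associative dprod_add.
Proof. by move=> f g h; apply/ffunP => i; rewrite !ffunE addrA. Qed.
Fact dprod_addC : commutative dprod_add.
Proof. by move=> f g; apply/ffunP => i; rewrite !ffunE addrC. Qed.
Fact dprod_add0 : left_id dprod_zero dprod_add.
Proof. by move=> f; apply/ffunP => i; rewrite !ffunE add0r. Qed.
Fact dprod_addN : left_inverse dprod_zero dprod_opp dprod_add.
Proof. by move=> f; apply/ffunP => i; rewrite !ffunE addNr. Qed.

HB.instance Definition _ :=
  GRing.isZmodule.Build dprod dprod_addA dprod_addC dprod_add0 dprod_addN.

Fact dprod_scaleA k l f : dprod_scale k (dprod_scale l f) = dprod_scale (k * l) f.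
Proof. by apply/ffunP => i; rewrite !ffunE scalerA. Qed.
Fact dprod_scale1 : left_id 1 dprod_scale.
Proof. by move=> f; apply/ffunP => i; rewrite !ffunE scale1r. Qed.
Fact dprod_scaleDr : right_distributive dprod_scale +%R.
Proof. by move=> k f g; apply/ffunP => i; rewrite !ffunE scalerDr. Qed.
Fact dprod_scaleDl f : {morph dprod_scale^~ f : k l / k + l}.
Proof. by move=> k l; apply/ffunP => i; rewrite !ffunE scalerDl. Qed.

HB.instance Definition _ := GRing.Zmodule_isLmodule.Build K dprod
  dprod_scaleA dprod_scale1 dprod_scaleDr dprod_scaleDl.

Lemma dprod0E i : (0 : dprod) i = 0. Proof. exact: ffunE. Qed.
Lemma dprodDE f g i : (f + g) i = f i + g i. Proof. exact: ffunE. Qed.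
Lemma dprodBE f g i : (f - g) i = f i - g i. Proof. by rewrite !ffunE. Qed.
Lemma dprodZE (k : K) f i : (k *: f) i = k *: f i. Proof. exact: ffunE. Qed.

End DProd.

Section GCast.
Variables (K : fieldType) (t : nat) (B : Zt t -> lmodType K).

(* The identity of B_a when a = a', and 0 otherwise. *)
Definition gcast (a a' : Zt t) (x : B a) : B a' :=
  if a =P a' is ReflectT e then ecast z (B z) e x else 0.

Lemma gcast_id a (x : B a) : gcast a x = x.
Proof. by rewrite /gcast; case: eqP => // e; rewrite eq_axiomK. Qed.

Lemma gcast_neq a a' (x : B a) : a <> a' -> gcast a' x = 0.
Proof. by rewrite /gcast; case: eqP. Qed.

Lemma gcast_comp a a' a'' (x : B a) :
  a = a' -> gcast a'' (gcast a' x) = gcast a'' x.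
Proof. by move=> e; case: _ / e; rewrite gcast_id. Qed.

Lemma gcast_linear a a' : linear (@gcast a a').
Proof.
move=> k x y; case: (a =P a') => [e|ne]; first by case: _ / e; rewrite !gcast_id.
by rewrite !gcast_neq // scaler0 addr0.
Qed.

HB.instance Definition _ a a' :=
  GRing.isLinear.Build K (B a) (B a') _ (@gcast a a') (@gcast_linear a a').

End GCast.

Section Free.
Variables (K : fieldType) (t : nat) (n : 'I_t -> nat).
Local Notation X := (var n).
Local Notation E := (ext K n).

Lemma wt0 : wt (set0 : {set X}) = 0.
Proof.
apply/ffunP => i; rewrite !ffunE; congr (_%:Z); apply/eqP.
by rewrite cards_eq0; apply/eqP/setP => x; rewrite !inE.
Qed.

Lemma wtU (A B : {set X}) : [disjoint A & B] -> wt (A :|: B) = wt A + wt B.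
Proof.
move=> dAB; apply/ffunP => i; rewrite !ffunE -PoszD; congr (_%:Z).
rewrite -cardsUI -[LHS]addn0; congr addn.
  by apply: eq_card => x; rewrite !inE andb_orl.
apply/esym/eqP; rewrite cards_eq0 -subset0; apply/subsetP => x; rewrite !inE.
case/andP=> /andP[xA _] /andP[xB _].
by move: dAB => /disjoint_setI0/setP/(_ x); rewrite !inE xA xB.
Qed.

Lemma wt_sub (A B : {set X}) : A \subset B -> led (wt A) (wt B).
Proof.
move=> /subsetP sAB; apply/forallP => i; rewrite !ffunE lez_nat.
by apply/subset_leq_card/subsetP => x; rewrite !inE => /andP[/sAB -> ->].
Qed.

Lemma ext_mulE (e f : E) : e * f = \sum_A f A *: (e * emon K A).
Proof.
by rewrite {1}[f]ext_sum mulr_sumr; apply: eq_bigr => A _; rewrite -scalerAr.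
Qed.

Lemma emon_mul (A B : {set X}) : emon K A * emon K B = emonM K A B.
Proof. exact: emul_mon. Qed.

Lemma mul_emonE (e : E) (U : {set X}) :
  e * emon K U = \sum_A e A *: emonM K A U.
Proof.
rewrite {1}[e]ext_sum mulr_suml.
by apply: eq_bigr => A _; rewrite -scalerAl emon_mul.
Qed.

Lemma ext_homog_mul s (e : E) (U W : {set X}) :
  ext_homog s e -> (e * emon K U) W != 0 -> wt W = wt U - s.
Proof.
move=> he; rewrite mul_emonE sum_ffunE => nz.
have [A] : exists A, (e A *: emonM K A U) W != 0.
  apply/existsP; apply: contraNT nz; rewrite negb_exists => /forallP z.
  by rewrite big1 // => A _; apply/eqP; rewrite -[_ == 0]negbK z.
rewrite ffunE [_ *: _]/(_ * _) mulf_eq0 negb_or => /andP[eA].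
rewrite /emonM; case: ifP => [dAU|]; last by rewrite ffunE eqxx.
rewrite !ffunE; case: (W =P _) => [-> _|_]; last by rewrite [_ *: _]mulr0 eqxx.
by rewrite wtU // (he A eA) opprK addrC.
Qed.

Section FreeMod.
Variable B : Zt t -> lmodType K.

(* \bigoplus_a B_a \otimes \omega_E(-a), where B_a \otimes \omega_E is
   identified with Hom_K(E, B_a). In degree b this is the space of K-linear maps
   f : E -> \bigoplus_a B_a sending E_{-s} to B_{b - s}, written as the family of
   the f(e_S); the summand of index a is given by the S with b - wt S = a.
   The right action of E is (f e)(x) = f(e x). *)
Definition free_grade (b : Zt t) : lmodType K :=
  dprod (fun S : {set X} => B (b - wt S)).

Definition free_act (b c : Zt t) (f : free_grade b) (e : E) : free_grade c :=
  [ffun S => \sum_U (e * emon K S) U *: gcast (c - wt S) (f U)].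

Fact free_act_linl b c e : linear (fun m : free_grade b => free_act c m e).
Proof.
move=> k f g; apply/ffunP => S; rewrite !ffunE scaler_sumr -big_split /=.
apply: eq_bigr => U _; rewrite !ffunE linearP scalerDr !scalerA.
by rewrite [k * _]mulrC.
Qed.

Fact free_act_linr b c (m : free_grade b) :
  linear (fun e : E => free_act c m e).
Proof.
move=> k e f; apply/ffunP => S; rewrite !ffunE scaler_sumr -big_split /=.
apply: eq_bigr => U _.
by rewrite mulrDl -scalerAl !ffunE scalerDl scalerA.
Qed.

Fact free_act_homog b c (m : free_grade b) s (e : E) :
  ext_homog s e -> s <> c - b -> free_act c m e = 0.
Proof.
move=> he ns; apply/ffunP => S; rewrite !ffunE big1 // => U _.
have [->|nz] := eqVneq ((e * emon K S) U) 0; first by rewrite scale0r.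
rewrite gcast_neq ?scaler0 // (ext_homog_mul he nz) => eq.
apply: ns; apply: (addrI (b - wt S)).
transitivity (c - wt S); first by rewrite -eq opprB addrA addrAC.
by rewrite [RHS]addrC addrA subrK.
Qed.

Fact free_act1 b (m : free_grade b) : free_act b m 1 = m.
Proof.
apply/ffunP => S; rewrite !ffunE (bigD1 S) //= big1 => [|U neUS].
  by rewrite mul1r ffunE eqxx scale1r gcast_id addr0.
by rewrite mul1r ffunE (negPf neUS) scale0r.
Qed.

Fact free_actM b c d (m : free_grade b) (e f : E) : ext_homog (c - b) e ->
  free_act d (free_act c m e) f = free_act d m (e * f).
Proof.
move=> he; apply/ffunP => S; rewrite !ffunE.
transitivity (\sum_U \sum_W
    ((f * emon K S) U * (e * emon K U) W) *: gcast (d - wt S) (m W)).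
  apply: eq_bigr => U _; rewrite ffunE linear_sum scaler_sumr.
  apply: eq_bigr => W _; rewrite linearZ /= scalerA.
  have [->|nz] := eqVneq ((e * emon K U) W) 0; first by rewrite mulr0 !scale0r.
  congr (_ *: _); apply: gcast_comp; rewrite (ext_homog_mul he nz).
  by rewrite !opprB addrA [b + _]addrC subrK.
rewrite exchange_big /=; apply: eq_bigr => W _; rewrite -scaler_suml.
congr (_ *: _); rewrite -mulrA [in RHS]ext_mulE sum_ffunE.
by apply: eq_bigr => U _; rewrite !ffunE.
Qed.

Definition free_mod : gmod K n :=
  GMod free_act_linl free_act_linr free_act_homog free_act1 free_actM.

End FreeMod.

Section FreeMap.
Variables (B B' : Zt t -> lmodType K) (u : forall a, {linear B a -> B' a}).

Definition free_map_fun b (f : free_mod B b) : free_mod B' b :=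
  [ffun S => u _ (f S)].

Fact free_map_linear b : linear (@free_map_fun b).
Proof. by move=> k f g; apply/ffunP => S; rewrite !ffunE linearP. Qed.

HB.instance Definition _ b := GRing.isLinear.Build K (free_mod B b)
  (free_mod B' b) _ (@free_map_fun b) (@free_map_linear b).

Fact gcast_map a a' (x : B a) : u a' (gcast a' x) = gcast a' (u a x).
Proof.
case: (a =P a') => [e|ne]; first by case: _ / e; rewrite !gcast_id.
by rewrite !gcast_neq // linear0.
Qed.

Definition free_map : ghom (free_mod B) (free_mod B').
Proof.
exists (fun b => @free_map_fun b : {linear _ -> _}) => b c m e.
apply/ffunP => S; rewrite !ffunE linear_sum; apply: eq_bigr => U _.
by rewrite linearZ /= gcast_map !ffunE.
Defined.

End FreeMap.

(* Morphisms of free modules do not lower the degrees of the generators. *)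
Lemma ghom_free_support (B B' : Zt t -> lmodType K)
    (phi : ghom (free_mod B) (free_mod B')) b (z : free_mod B b) (S : {set X}) :
  (forall U : {set X}, S \subset U -> z U = 0) -> phi b z S = 0.
Proof.
move=> zS; pose c := b - wt S.
have ec : b - wt S = c - wt (set0 : {set X}) by rewrite wt0 subr0.
have z0 : act (free_mod B) c z (emon K S) = 0.
  apply/ffunP => W; rewrite !ffunE big1 // => U _.
  rewrite emon_mul /emonM; case: ifP => _; last by rewrite ffunE scale0r.
  rewrite !ffunE; case: (U =P _) => [->|_]; last by rewrite [_ *: 0]mulr0 scale0r.
  by rewrite zS ?subsetUl // linear0 scaler0.
have /ffunP/(_ set0) := @hmap_act _ _ _ _ _ phi b c z (emon K S).
rewrite z0 linear0 !ffunE (bigD1 S) //= big1 => [|U neUS].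
  rewrite emon_mul emonM0r ffunE eqxx scale1r addr0 => /esym h.
  have := congr1 (gcast (b - wt S)) h.
  by rewrite gcast_comp // gcast_id linear0.
by rewrite emon_mul emonM0r ffunE (negPf neUS) scale0r.
Qed.

End Free.

(* The component of the differential from term p to term q is 0 unless
   q = p + 1; allowing all pairs (p, q) avoids transports along equalities of
   indices. *)
Record complex (K : fieldType) (t : nat) (n : 'I_t -> nat) := Complex {
  term :> int -> gmod K n;
  diff : forall p q, ghom (term p) (term q);
  diff_off : forall p q, q <> p + 1 -> forall b x, diff p q b x = 0;
  diff_diff : forall p q r b x, diff q r b (diff p q b x) = 0
}.
Arguments diff {K t n} c p q.

Record cmap (K : fieldType) (t : nat) (n : 'I_t -> nat) (A B : complex K n) := CMap {
  cmap_hom :> forall p, ghom (A p) (B p);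
  cmap_comm : forall p q b x,
    diff B p q b (cmap_hom p b x) = cmap_hom q b (diff A p q b x)
}.

Section Complexes.
Variables (K : fieldType) (t : nat) (n : 'I_t -> nat).
Implicit Types A B C : complex K n.

Definition exact C : Prop := forall p b (x : C p b),
  diff C p (p + 1) b x = 0 -> exists y : C (p - 1) b, diff C (p - 1) p b y = x.

Definition fin_dim (V : lmodType K) : Prop :=
  exists (m : nat) (s : 'I_m -> V), forall v,
    exists c : 'I_m -> K, v = \sum_i c i *: s i.

(* For every b, the direct sum of the C^p_b over all p is finite dimensional. *)
Definition locally_finite C : Prop := forall b : Zt t,
  (exists N : nat, forall p, (N < `|p|)%N -> forall x : C p b, x = 0) /\
  (forall p, fin_dim (C p b)).

Definition cmap_comp A B C (g : cmap B C) (f : cmap A B) : cmap A C.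
Proof.
exists (fun p => ghom_comp (g p) (f p)) => p q b x /=.
by rewrite !cmap_comm.
Defined.

(* C[k]^p = C^(k + p); the differential is multiplied by (-1)^k. *)
Definition shift (k : int) C : complex K n.
Proof.
exists (fun p => C (k + p))
  (fun p q => ghom_scale ((-1 : K) ^ k) (diff C (k + p) (k + q))) => /=.
- move=> p q ne b x /=; rewrite diff_off ?scaler0 // -addrA => /addrI.
  exact: ne.
- by move=> p q r b x /=; rewrite linearZ /= diff_diff !scaler0.
Defined.

(* The identity of C^p when p = q, and 0 otherwise. *)
Definition tcast C (p q : int) : ghom (C p) (C q) :=
  if p =P q is ReflectT e then ecast z (ghom (C p) (C z)) e (ghom_id (C p))
  else ghom_zero (C p) (C q).

Lemma tcast_id C p b (x : C p b) : tcast C p p b x = x.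
Proof. by rewrite /tcast; case: eqP => // e; rewrite eq_axiomK. Qed.

Lemma tcast_neq C p q b (x : C p b) : p <> q -> tcast C p q b x = 0.
Proof. by rewrite /tcast; case: eqP. Qed.

Lemma tcast_diff C p q p' q' b (x : C p b) : q - p = q' - p' ->
  diff C p' q' b (tcast C p p' b x) = tcast C q q' b (diff C p q b x).
Proof.
move=> e; case: (p =P p') => [epp|npp].
  case: _ / epp e => e.
  by move: (addIr _ e) => eqq; case: _ / eqq; rewrite !tcast_id.
rewrite [in LHS]tcast_neq // linear0 tcast_neq // => eqq; apply: npp.
by move: e; rewrite eqq => /addrI/oppr_inj.
Qed.

Definition shift0 C : cmap (shift (- 0%:Z) C) C.
Proof.
exists (fun p => tcast C (- 0%:Z + p) p) => p q b x /=.
by rewrite expr0z scale1r; apply: tcast_diff; rewrite oppr0 !add0r.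
Defined.

Section Cone.
Variables (A B : complex K n) (f : cmap A B).

Definition cone_mod (p : int) : gmod K n.
Proof.
exists (fun b => prod (A (1 + p) b) (B p b) : lmodType K)
  (fun b c m e => (act (A (1 + p)) c m.1 e, act (B p) c m.2 e)).
- by move=> b c e k x y /=; rewrite !act_linl.
- by move=> b c m k e f' /=; rewrite !act_linr.
- by move=> b c m s e he ns /=; rewrite !(act_homog _ he ns).
- by move=> b [m1 m2] /=; rewrite !act1.
- by move=> b c d m e f' he /=; rewrite !actM.
Defined.

(* (x, y) |-> (- d x, f x + d y) *)
Definition cone_diff_fun (p q : int) b (x : cone_mod p b) : cone_mod q b :=
  (diff (shift 1 A) p q b x.1,
   f q b (tcast A (1 + p) q b x.1) + diff B p q b x.2).

Fact cone_diff_linear p q b : linear (@cone_diff_fun p q b).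
Proof.
move=> k x y; apply: injective_projections.
  exact: (linearP (diff (shift 1 A) p q b)).
rewrite [LHS]/= (linearP (tcast A (1 + p) q b)) (linearP (f q b)).
rewrite (linearP (diff B p q b)) addrACA -scalerDr; reflexivity.
Qed.

HB.instance Definition _ p q b := GRing.isLinear.Build K (cone_mod p b)
  (cone_mod q b) _ (@cone_diff_fun p q b) (@cone_diff_linear p q b).

Definition cone_diff (p q : int) : ghom (cone_mod p) (cone_mod q).
Proof.
exists (fun b => @cone_diff_fun p q b : {linear _ -> _}) => b c m e.
rewrite /cone_diff_fun /=; congr pair.
  exact: (hmap_act (diff (shift 1 A) p q)).
rewrite !hmap_act; have := act_linl (g := B q) c e 1.
by move=> h; rewrite -[X in act _ c (X + _)]scale1r h scale1r.
Defined.

Definition cone : complex K n.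
Proof.
exists cone_mod cone_diff => [p q ne b x | p q r b x] /=.
  have ne1 : 1 + q <> 1 + p + 1 by rewrite -addrA => /addrI.
  have ne2 : 1 + p <> q by rewrite addrC => /esym.
  rewrite /cone_diff_fun /= (diff_off ne) (diff_off ne1) (tcast_neq _ ne2).
  by rewrite scaler0 linear0 addr0.
rewrite /cone_diff_fun /= linearZ /= diff_diff !scaler0; congr pair.
rewrite linearD /= diff_diff addr0 cmap_comm -linearD /= expr1z scaleN1r linearN /=.
case: (q =P p + 1) => [eq1|ne].
  case: (r =P q + 1) => [er|ne].
    have e : 1 + q - (1 + p) = r - q.
      by rewrite er opprD addrACA subrr add0r [q + 1]addrC addrK eq1 addrC addKr.
    by rewrite (tcast_diff _ e) addNr linear0.
  have ne2 : 1 + q <> r by rewrite addrC => /esym.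
  by rewrite (tcast_neq _ ne2) (diff_off ne) oppr0 addr0 linear0.
have ne1 : 1 + q <> 1 + p + 1 by rewrite -addrA => /addrI.
have ne2 : 1 + p <> q by rewrite addrC => /esym.
by rewrite (diff_off ne1) (tcast_neq _ ne2) !linear0 ?oppr0 ?addr0 ?linear0.
Defined.

End Cone.
End Complexes.

Record free_complex (K : fieldType) (t : nat) (n : 'I_t -> nat) := FreeComplex {
  gens : int -> Zt t -> lmodType K;
  fdiff : forall p q, ghom (free_mod n (gens p)) (free_mod n (gens q));
  fdiff_off : forall p q, q <> p + 1 -> forall b x, fdiff p q b x = 0;
  fdiff_fdiff : forall p q r b x, fdiff q r b (fdiff p q b x) = 0
}.
Arguments fdiff {K t n} f p q.

Definition complex_of_free (K : fieldType) (t : nat) (n : 'I_t -> nat)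
    (T : free_complex K n) : complex K n :=
  Complex (@fdiff_off _ _ _ T) (@fdiff_fdiff _ _ _ T).
Coercion complex_of_free : free_complex >-> complex.

Section Regions.
Variables (K : fieldType) (t : nat) (n : 'I_t -> nat).

Definition convex (P : pred (Zt t)) : Prop :=
  forall a a' a'', P a -> P a'' -> led a a' -> led a' a'' -> P a'.

Section Restr.
Variables (P : pred (Zt t)) (B : Zt t -> lmodType K).

(* B_a for a in P, and 0 for the other a. *)
Definition restr (a : Zt t) : lmodType K := if P a then B a else 'rV[K]_0.

Definition restr_in (a : Zt t) : {linear restr a -> B a} :=
  if P a as c return {linear (if c then B a else 'rV[K]_0) -> B a}
  then idfun else \0.

Definition restr_out (a : Zt t) : {linear B a -> restr a} :=
  if P a as c return {linear B a -> (if c then B a else 'rV[K]_0)}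
  then idfun else \0.

Lemma restr_in_out a x : restr_in a (restr_out a x) = if P a then x else 0.
Proof. by rewrite /restr_in /restr_out /restr; case: (P a). Qed.

Lemma restr_out_in a x : restr_out a (restr_in a x) = x.
Proof.
rewrite /restr_in /restr_out; move: x; rewrite /restr.
by case: (P a) => //= x; rewrite [x]thinmx0.
Qed.

Lemma restr_in_notin a x : ~~ P a -> restr_in a x = 0.
Proof. by rewrite /restr_in; move: x; rewrite /restr; case: (P a). Qed.

Lemma restr0 a (x : restr a) : ~~ P a -> x = 0.
Proof. by move: x; rewrite /restr; case: (P a) => // x _; rewrite [x]thinmx0. Qed.

Definition region_in : ghom (free_mod n (restr)) (free_mod n B) :=
  free_map n restr_in.
Definition region_out : ghom (free_mod n B) (free_mod n restr) :=
  free_map n restr_out.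

End Restr.

Variable T : free_complex K n.
Implicit Types P Q R : pred (Zt t).

(* The component of the differential of T from the summands of T^p with a in P
   to the summands of T^q with a in Q. *)
Definition blk P Q (p q : int) :
    ghom (free_mod n (restr P (gens T p))) (free_mod n (restr Q (gens T q))) :=
  ghom_comp (region_out Q (gens T q))
            (ghom_comp (fdiff T p q) (region_in P (gens T p))).

Lemma blk_off P Q p q : q <> p + 1 -> forall b x, blk P Q p q b x = 0.
Proof. by move=> ne b x; rewrite /= (fdiff_off ne) linear0. Qed.

Lemma led_sub (b : Zt t) (S U : {set var n}) :
  S \subset U -> led (b - wt U) (b - wt S).
Proof.
move=> /wt_sub/forallP le; apply/forallP => i.
by rewrite !ffunE lerD2l lerN2; have := le i; rewrite !ffunE.
Qed.

Lemma blk_blk P Q R :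
  (forall a a' a'', P a -> Q a'' -> led a a' -> led a' a'' -> R a') ->
  forall p q r b x, blk R Q q r b (blk P R p q b x) = 0.
Proof.
move=> PQR p q r b x.
set y := fdiff T p q b (region_in P (gens T p) b x).
pose z : free_mod n (gens T q) b :=
  [ffun S => if R (b - wt S) then y S else 0].
have zE : region_in R (gens T q) b (region_out R (gens T q) b y) = z.
  by apply/ffunP => S; rewrite !ffunE restr_in_out.
rewrite [LHS]/= -/y zE.
apply/ffunP => S; rewrite dprod0E ffunE.
case QS : (Q (b - wt S)); last by apply: restr0; rewrite QS.
suff -> : fdiff T q r b z S = 0 by rewrite linear0.
have dy : fdiff T q r b y = 0 by exact: fdiff_fdiff.
have -> : z = y - (y - z) by rewrite opprB addrC subrK.
rewrite linearB /= dy sub0r; apply/eqP; rewrite !ffunE oppr_eq0; apply/eqP.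
apply: ghom_free_support => U SU; rewrite !ffunE.
case RU : (R (b - wt U)); first by rewrite subrr.
rewrite subr0; apply: ghom_free_support => W UW; rewrite ffunE.
apply: restr_in_notin; apply: contraFN RU => PW.
exact: (PQR _ _ _ PW QS (led_sub b UW) (led_sub b SU)).
Qed.

(* The subquotient complex of T spanned by the summands with a in P. *)
Definition subquotient P (cP : convex P) : free_complex K n.
Proof.
exists (fun p => restr P (gens T p)) (blk P P) => [p q|p q r b x].
  exact: blk_off.
exact: blk_blk.
Defined.

Definition region (c : Zt t) (I J L : {set 'I_t}) : pred (Zt t) := fun a =>
  [&& [forall i in I, a i < c i], [forall i in J, a i == c i]
    & [forall i in L, c i <= a i]].

Lemma region_convex c I J L : convex (region c I J L).
Proof.
move=> a a' a'' /and3P[_ /forall_inP aJ /forall_inP aL].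
move=> /and3P[/forall_inP aI /forall_inP aJ' _] /forallP le1 /forallP le2.
apply/and3P; split; apply/forall_inP => i ii.
- exact: le_lt_trans (le2 i) (aI i ii).
- rewrite eq_le -{1}(eqP (aJ' i ii)) le2 /=.
  by rewrite -(eqP (aJ i ii)) le1.
- exact: le_trans (aL i ii) (le1 i).
Qed.

Definition region_complex c I J L : free_complex K n :=
  subquotient (@region_convex c I J L).

Definition strand (c : Zt t) (J : {set 'I_t}) := region_complex c set0 J set0.

Definition qregion (c : Zt t) (I : {set 'I_t}) := region c I set0 (~: I).
Definition qT (c : Zt t) (I : {set 'I_t}) := region_complex c I set0 (~: I).

(* {1, ..., k}: 'I_t is numbered from 0. *)
Definition initial (k : nat) : {set 'I_t} := [set i : 'I_t | (i < k)%N].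

Lemma initial0 : initial 0 = set0.
Proof. by apply/setP => i; rewrite !inE. Qed.

Lemma initialt : initial t = setT.
Proof. by apply/setP => i; rewrite !inE ltn_ord. Qed.

Lemma blk_anticomm P Q : (forall a, P a -> ~~ Q a) ->
  (forall a a' a'', P a -> Q a'' -> led a a' -> led a' a'' -> P a' || Q a') ->
  forall p q r b x,
  blk Q Q q r b (blk P Q p q b x) = - blk P Q q r b (blk P P p q b x).
Proof.
move=> dPQ iPQ p q r b x; apply/eqP; rewrite -addr_eq0 addrC; apply/eqP.
rewrite -(@blk_blk P Q (fun a => P a || Q a) iPQ p q r b x) /=.
set y := fdiff T p q b _.
rewrite -!linearD; congr (region_out _ _ b (fdiff T q r b _)).
apply/ffunP => S; rewrite !ffunE !restr_in_out.
case PS : (P (b - wt S)); last by rewrite add0r.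
by rewrite (negPf (dPQ _ PS)) addr0.
Qed.

Lemma qregion_anticomm c k p q r b x :
  let P := qregion c (initial k.+1) in let Q := qregion c (initial k) in
  blk Q Q q r b (blk P Q p q b x) = - blk P Q q r b (blk P P p q b x).
Proof.
move=> P Q; have [kt|tk] := ltnP k t.
  apply: blk_anticomm => [a|a a' a''].
    move=> /and3P[/forall_inP/(_ (Ordinal kt)) h _ _].
    apply/negP => /and3P[_ _ /forall_inP/(_ (Ordinal kt))].
    move: h; rewrite !inE /= ltnS ltnn leqnn => /(_ isT) h /(_ isT).
    by rewrite leNgt h.
  move=> /and3P[_ _ /forall_inP aL] /and3P[/forall_inP aI _ _].
  move=> /forallP le1 /forallP le2.
  have lo (i : 'I_t) : (i < k)%N -> a' i < c i.
    by move=> ik; apply: le_lt_trans (le2 i) (aI i _); rewrite inE.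
  have hi (i : 'I_t) : (k < i)%N -> c i <= a' i.
    move=> ki; apply: le_trans (le1 i); apply: aL.
    by rewrite !inE -leqNgt.
  have e0 : [forall i in (set0 : {set 'I_t}), a' i == c i].
    by apply/forall_inP => i; rewrite inE.
  have eqk (i : 'I_t) : (i : nat) = k -> i = Ordinal kt by move=> ?; apply: val_inj.
  rewrite /P /Q /qregion /region e0 /=.
  have [ltk|gek] := ltP (a' (Ordinal kt)) (c (Ordinal kt)).
    apply/orP; left; apply/andP; split; apply/forall_inP => i; rewrite !inE.
      by rewrite ltnS leq_eqVlt => /predU1P[/eqk -> //|/lo].
    by rewrite -leqNgt => /hi.
  apply/orP; right; apply/andP; split; apply/forall_inP => i; rewrite !inE.
    exact: lo.
  by rewrite -leqNgt leq_eqVlt => /predU1P[/esym/eqk -> //|/hi].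
have ePQ : P = Q.
  rewrite /P /Q; congr (qregion c _); apply/setP => i; rewrite !inE.
  by rewrite !(leq_trans (ltn_ord i)) // leqW.
have cQ := @region_convex c (initial k) set0 (~: initial k).
have cP := @region_convex c (initial k.+1) set0 (~: initial k.+1).
rewrite (@blk_blk P Q Q); last by rewrite ePQ; exact: cQ.
by rewrite (@blk_blk P Q P) ?oppr0 // -ePQ; exact: cP.
Qed.

(* The connecting morphism qT_{c,{1..k+1}}[-1] -> qT_{c,{1..k}} of the termwise
   split extension T_c({1..k}, \emptyset, {k+2..t}), shifted by -k: its components
   are those of the differential of T. *)
Definition corner_step (c : Zt t) (k : nat) :
  cmap (shift (- k.+1%:Z) (qT c (initial k.+1))) (shift (- k%:Z) (qT c (initial k))).
Proof.
exists (fun p => blk (qregion c (initial k.+1)) (qregion c (initial k))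
                   (- k.+1%:Z + p) (- k%:Z + p)) => p q b x.
set Q := qregion c (initial k); set P := qregion c (initial k.+1).
change ((-1 : K) ^ (- k%:Z) *: blk Q Q (- k%:Z + p) (- k%:Z + q) b
    (blk P Q (- k.+1%:Z + p) (- k%:Z + p) b x) =
  blk P Q (- k.+1%:Z + q) (- k%:Z + q) b
    ((-1 : K) ^ (- k.+1%:Z) *: blk P P (- k.+1%:Z + p) (- k.+1%:Z + q) b x)).
rewrite [RHS]linearZ_LR.
case: (q =P p + 1) => [e|ne]; last first.
  have ne1 (m : int) : m + q <> m + p + 1 by rewrite -addrA => /addrI.
  by rewrite (@blk_off Q Q _ _ (ne1 _)) (@blk_off P P _ _ (ne1 _)) !linear0 ?scaler0 ?linear0.
have -> : - k.+1%:Z + q = - k%:Z + p.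
  by rewrite e -addn1 PoszD opprD addrACA addNr addr0.
have -> : (-1 : K) ^ (- k.+1%:Z) = - (-1) ^ (- k%:Z).
  by rewrite -!exprnN !invr_sign exprS mulN1r.
by rewrite qregion_anticomm scalerN scaleNr.
Defined.

Fixpoint corner_iter (c : Zt t) (k : nat) :
    cmap (shift (- k%:Z) (qT c (initial k))) (qT c (initial 0)) :=
  match k with
  | 0 => shift0 (qT c (initial 0))
  | k'.+1 => cmap_comp (corner_iter c k') (corner_step c k')
  end.

(* [initial t] is {1, ..., t} and [initial 0] is empty, see initialt and initial0. *)
Definition T_lt (c : Zt t) := qT c (initial t).
Definition T_ge (c : Zt t) := qT c (initial 0).

Definition corner_map (c : Zt t) : cmap (shift (- t%:Z) (T_lt c)) (T_ge c) :=
  corner_iter c t.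

Definition corner (c : Zt t) : complex K n := cone (corner_map c).

End Regions.

(* Main.v *)
Require Import Defs.
From HB Require Import structures.
From mathcomp Require Import all_boot all_order all_algebra.
Set Implicit Arguments.
Unset Strict Implicit.
Unset Printing Implicit Defensive.
Import Order.TTheory GRing.Theory Num.Theory.
Local Open Scope ring_scope.

(* In multidegree [b] only the summands [omega_E(-a)] with [0 <= b_i - a_i <= n_i + 1]
   are nonzero, so exactness in degree [b] sees only a finite box of generator
   degrees.
   1 => 2: in degree [b] a region complex is a finite iterated extension of strands.
   2 => 3: each step of the corner map is the connecting morphism of an exact
   proper region complex, hence a quasi-isomorphism.
   4 => 5: if [c_i > b_i] for [i] outside [I], then [T_{>=c}] vanishes in degree [b]
   while [T_{<c}] agrees there with [T_c(I, 0, 0)].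
   5 => 1: the differential of [S = T_c(0, J, 0)] preserves the coordinates in [J],
   so [S] is a complex over the remaining variables tensored with [omega] of the
   variables in [J]; it is therefore exact as soon as it is exact in the degrees
   [b] with [b_i = c_i + n_i + 1] for [i] in [J].  In those degrees it agrees with
   [T_{c+1}(J, 0, 0)].  The same principle, applied to the slice [a_i = c_i] of
   [T_{c+e_i}(I, 0, 0)], lowers [c] one coordinate at a time from the large values
   given by 5 to all values. *)

(** * Exactness by multidegree, quasi-isomorphisms and cones *)

Section ExactComplexes.
Variables (K : fieldType) (t : nat) (n : 'I_t -> nat).
Implicit Types A B C : complex K n.

(** The positions are variables tied by equations, so that shifted indices match without
    transport. *)
Definition exact_at C (b : Zt t) : Prop :=
  forall p q r, q = p + 1 -> r = q + 1 -> forall x : C q b,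
  diff C q r b x = 0 -> exists y : C p b, diff C p q b y = x.

Lemma exactE C : exact C <-> forall b, exact_at C b.
Proof.
split=> [exC b p q r eq er x | exC p b x dx].
  have ep : p = q - 1 by rewrite eq addrK.
  by rewrite er ep; exact: exC.
by apply: exC dx; rewrite // subrK.
Qed.

Lemma signz_neq0 (m : int) : (-1 : K) ^ m != 0.
Proof. by rewrite expfz_neq0 // oppr_eq0 oner_eq0. Qed.

Lemma diff_shift (k : int) C p q b (x : C (k + p) b) :
  diff (shift k C) p q b x = (-1) ^ k *: diff C (k + p) (k + q) b x.
Proof. by []. Qed.

Lemma diff_shift_eq0 (k : int) C p q b (x : C (k + p) b) :
  diff (shift k C) p q b x = 0 <-> diff C (k + p) (k + q) b x = 0.
Proof.
rewrite diff_shift; split=> [/eqP | ->]; last by rewrite scaler0.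
by rewrite scaler_eq0 (negPf (signz_neq0 _)) => /eqP.
Qed.

Lemma exact_at_shift (k : int) C b : exact_at (shift k C) b -> exact_at C b.
Proof.
move=> exC p q r eq er x dx.
have kp (m : int) : m = k + (m - k) by rewrite addrC subrK.
move: x dx; rewrite (kp p) (kp q) (kp r) => x dx.
have [|||y /= <-] := exC (p - k) (q - k) (r - k) _ _ x.
- by rewrite eq addrAC.
- by rewrite er addrAC.
- by rewrite /= dx scaler0.
by exists ((-1) ^ k *: y); rewrite linearZ.
Qed.

(** Injectivity and surjectivity on cohomology at [q], phrased with cycles and boundaries so that no
    quotient is formed. *)
Definition qis A B (f : cmap A B) : Prop := forall p q r b,
  q = p + 1 -> r = q + 1 ->
  (forall (x : A q b) (v : B p b), diff A q r b x = 0 -> f q b x = diff B p q b v ->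
     exists u : A p b, diff A p q b u = x) /\
  (forall y : B q b, diff B q r b y = 0 ->
     exists (x : A q b) (v : B p b),
       diff A q r b x = 0 /\ y = f q b x + diff B p q b v).

Lemma qis_comp A B C (g : cmap B C) (f : cmap A B) :
  qis g -> qis f -> qis (cmap_comp g f).
Proof.
move=> qg qf p q r b eq er; have [gi gs] := qg p q r b eq er.
have [fi fs] := qf p q r b eq er; split=> [x v dx /= gfx | y dy].
  have [|w /esym fx] := gi (f q b x) v _ gfx; first by rewrite cmap_comm dx linear0.
  exact: fi fx.
have [y' [v [dy' ->]]] := gs y dy; have [x [w [dx ->]]] := fs y' dy'.
exists x, (g p b w + v); split=> //=.
by rewrite !linearD /= cmap_comm addrA.
Qed.

Lemma tcastK C p q b : p = q -> cancel (Defs.tcast C p q b) (Defs.tcast C q p b).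
Proof. by move=> <- x; rewrite /= !Defs.tcast_id. Qed.

Lemma qis_shift0 C : qis (shift0 C).
Proof.
move=> p q r b eq er.
have z0 (m : int) : m = - 0%:Z + m by rewrite oppr0 add0r.
have sd (m m' : int) (u : C m b) : diff C (- 0%:Z + m) (- 0%:Z + m') b
     (Defs.tcast C m (- 0%:Z + m) b u) =
   Defs.tcast C m' (- 0%:Z + m') b (diff C m m' b u).
  by apply: tcast_diff; rewrite -!z0.
split=> [x v dx /= fx | y dy].
  exists (Defs.tcast C p (- 0%:Z + p) b v) => /=.
  by rewrite expr0z scale1r sd -fx tcastK // -z0.
exists (Defs.tcast C q (- 0%:Z + q) b y), 0; split=> /=.
  by rewrite expr0z scale1r sd dy linear0.
by rewrite tcastK // linear0 addr0.
Qed.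

(** For a cycle [(x, y)] of the cone, [f x = - d y], so injectivity gives [x = d u]. Then [y + f u]
    is a cycle, equal to [f w + d v] with [d w = 0] by surjectivity, and [(w - u, v)] bounds
    [(x, y)]. *)
Lemma qis_cone_exact A B (f : cmap A B) : qis f -> exact (cone f).
Proof.
move=> qf; apply/exactE => b p q r eq er [x y] [].
have ep1 : q = 1 + p by rewrite eq addrC.
have eq1 : 1 + q = r by rewrite er addrC.
rewrite /= expr1z scaleN1r => /eqP; rewrite oppr_eq0 => /eqP dx fx.
pose x' := Defs.tcast A (1 + q) r b x.
have dx' : diff A r (r + 1) b x' = 0.
  have e : r + 1 - r = 1 + r - (1 + q) by rewrite eq1 [1 + r]addrC.
  by rewrite (tcast_diff _ (esym e)) dx linear0.
have [fi _] := qf q r (r + 1) b er erefl.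
have [_ fs] := qf p q r b eq er.
have [|u du] := fi x' (- y) dx'.
  by rewrite linearN; apply/eqP; rewrite -addr_eq0 fx.
have [|w [v [dw yE]]] := fs (y + f q b u).
  by rewrite linearD /= cmap_comm du addrC.
exists (Defs.tcast A q (1 + p) b (w - u), v); rewrite /cone_diff_fun /=.
congr pair.
  rewrite expr1z scaleN1r (@tcast_diff _ _ _ A q r); last by rewrite eq1 ep1.
  by rewrite linearB /= dw du sub0r linearN opprK /x' tcastK.
by rewrite tcastK // linearB /= -addrA [- _ + _]addrC addrA -yE addrK.
Qed.

(** In a degree where [B] vanishes, the cone is [A[1]]. *)
Lemma cone_exact_at A B (f : cmap A B) b :
  (forall p (y : B p b), y = 0) -> exact_at (cone f) b -> exact_at A b.
Proof.
move=> B0 exf p q r eq er x dx.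
have up (m : int) : m = 1 + (m - 1) by rewrite addrC subrK.
move: x dx; rewrite (up p) (up q) (up r) => x dx.
have [|||[y z] [/= <- _]] := exf (p - 1) (q - 1) (r - 1) _ _ (x, 0).
- by rewrite eq addrAC.
- by rewrite er addrAC.
- by rewrite /= /cone_diff_fun /= dx scaler0; congr pair; apply: B0.
by exists ((-1) ^ 1 *: y); rewrite linearZ.
Qed.

End ExactComplexes.

(** * Regions as images of projectors on the terms of [T] *)

Section Blocks.
Variables (K : fieldType) (t : nat) (n : 'I_t -> nat) (T : free_complex K n).
Implicit Types (P Q R : pred (Zt t)) (b c : Zt t) (I J L : {set 'I_t}).
Implicit Types A S U : {set var n}.
Local Notation fm p := (free_mod n (gens T p)).

(** Passing through [restr] and back gives an idempotent of the term of [T] itself, so different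
    regions are compared inside one type. *)
Definition prj P p : ghom (fm p) (fm p) :=
  ghom_comp (region_in n P (gens T p)) (region_out n P (gens T p)).

Lemma prjE P p b (x : fm p b) S :
  prj P p b x S = if P (b - wt S) then x S else 0.
Proof. by rewrite !ffunE restr_in_out. Qed.

Lemma eq_prj P Q b : (forall S : {set var n}, P (b - wt S) = Q (b - wt S)) ->
  forall p (x : fm p b), prj P p b x = prj Q p b x.
Proof. by move=> PQ p x; apply/ffunP => S; rewrite !prjE PQ. Qed.

Lemma prj_id P p b (x : fm p b) : prj P p b (prj P p b x) = prj P p b x.
Proof. by apply/ffunP => S; rewrite !prjE; case: (P _). Qed.

Definition dblk P Q p q : ghom (fm p) (fm q) :=
  ghom_comp (prj Q q) (ghom_comp (fdiff T p q) (prj P p)).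

Lemma dblkE P Q p q b x :
  dblk P Q p q b x = prj Q q b (fdiff T p q b (prj P p b x)).
Proof. by []. Qed.

Lemma eq_dblk P P' Q Q' b :
  (forall S : {set var n}, P (b - wt S) = P' (b - wt S)) ->
  (forall S : {set var n}, Q (b - wt S) = Q' (b - wt S)) ->
  forall p q (x : fm p b), dblk P Q p q b x = dblk P' Q' p q b x.
Proof.
by move=> eP eQ p q x; rewrite !dblkE (eq_prj eP) (eq_prj eQ).
Qed.

(* Exactness in degree [b] of the part of [T] with generator degrees in [P], stated
   inside [T] so that it visibly depends only on the values of [P] at [b - wt S]. *)
Definition exact_on P b : Prop := forall p q r, q = p + 1 -> r = q + 1 ->
  forall x : fm q b, prj P q b x = x -> dblk P P q r b x = 0 ->
  exists y : fm p b, dblk P P p q b y = x.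

Lemma eq_exact_on P Q b : (forall S : {set var n}, P (b - wt S) = Q (b - wt S)) ->
  exact_on P b -> exact_on Q b.
Proof.
move=> PQ exP p q r eq er x xQ dx.
have [||y <-] := exP p q r eq er x; first by rewrite (eq_prj PQ).
  by rewrite (eq_dblk PQ PQ).
by exists y; rewrite (eq_dblk PQ PQ).
Qed.

Lemma exact_on_pred0 P b : (forall S : {set var n}, ~~ P (b - wt S)) -> exact_on P b.
Proof.
move=> P0 p q r _ _ x <- _; exists 0; rewrite linear0; apply/esym/ffunP => S.
by rewrite prjE (negPf (P0 S)) ffunE.
Qed.

Lemma region_out_in P p b (x : free_mod n (restr P (gens T p)) b) :
  region_out n P (gens T p) b (region_in n P (gens T p) b x) = x.
Proof. by apply/ffunP => S; rewrite !ffunE restr_out_in. Qed.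

Lemma prj_region_in P p b (x : free_mod n (restr P (gens T p)) b) :
  prj P p b (region_in n P (gens T p) b x) = region_in n P (gens T p) b x.
Proof. by rewrite -{2}[x]region_out_in. Qed.

Lemma region_in_blk P Q p q b (x : free_mod n (restr P (gens T p)) b) :
  region_in n Q (gens T q) b (blk T P Q p q b x) =
  dblk P Q p q b (region_in n P (gens T p) b x).
Proof. by rewrite [RHS]/= region_out_in. Qed.

Lemma region_out_dblk P Q p q b (x : fm p b) :
  region_out n Q (gens T q) b (dblk P Q p q b x) =
  blk T P Q p q b (region_out n P (gens T p) b x).
Proof. by rewrite [LHS]/= region_out_in. Qed.

Lemma subquotient_exact_on P (cP : convex P) b :
  exact_at (subquotient T cP) b <-> exact_on P b.
Proof.
split=> exP p q r eq er x.
  move=> xP dx.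
  have [|y dy] := exP p q r eq er (region_out n P (gens T q) b x).
    by rewrite -[LHS]region_out_dblk dx linear0.
  exists (region_in n P (gens T p) b y).
  by rewrite -region_in_blk -[RHS]xP; congr (region_in n P _ b _).
move=> dx; have [||y dy] := exP p q r eq er (region_in n P (gens T q) b x).
- exact: prj_region_in.
- by rewrite -region_in_blk [blk _ _ _ _ _ _ _]dx linear0.
exists (region_out n P (gens T p) b y).
by rewrite -[LHS]region_out_dblk dy region_out_in.
Qed.

(* Otherwise [/=] unfolds them through [hmap]. *)
Opaque prj dblk.

Lemma dblk_prj P Q p q b (x : fm p b) : dblk P Q p q b (prj P p b x) = dblk P Q p q b x.
Proof. by rewrite !dblkE prj_id. Qed.

Lemma prj_dblk P Q p q b (x : fm p b) : prj Q q b (dblk P Q p q b x) = dblk P Q p q b x.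
Proof. by rewrite !dblkE prj_id. Qed.

Lemma dblk_dblk P p q r b (x : fm p b) : convex P ->
  dblk P P q r b (dblk P P p q b x) = 0.
Proof.
move=> cP; rewrite -(dblk_prj P P q) -[prj P p b x]/(region_in _ _ _ _ _).
rewrite -region_in_blk -region_in_blk.
by rewrite (@blk_blk _ _ _ T P P P cP p q r b) linear0.
Qed.

(* The differential raises generator degrees, so the last condition makes [R] a
   subcomplex of [P], with quotient [Q]. *)
Definition extension P Q R : Prop := [/\ convex P, forall a, P a = Q a || R a
  & forall a a'', R a -> Q a'' -> ~~ led a a''].

(** * Termwise split extensions and their connecting morphisms *)

Section Extension.
Variables P Q R : pred (Zt t).
Hypothesis ePQR : extension P Q R.

Lemma led_refl (a : Zt t) : led a a. Proof. exact/forallP. Qed.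

Lemma extension_disj a : Q a -> R a = false.
Proof.
by case: ePQR => _ _ h Qa; apply/negP => Ra; have := h _ _ Ra Qa; rewrite led_refl.
Qed.

Lemma dblk_RQ p q b (x : fm p b) : dblk R Q p q b x = 0.
Proof.
case: ePQR => _ _ h; rewrite dblkE; apply/ffunP => S; rewrite prjE [RHS]dprod0E.
case QS: (Q _) => //; apply: ghom_free_support => U SU; rewrite prjE.
by case RU: (R _) => //; have := h _ _ RU QS; rewrite led_sub.
Qed.

Lemma prj_ext p b (x : fm p b) : prj P p b x = prj Q p b x + prj R p b x.
Proof.
case: ePQR => _ PE _; apply/ffunP => S; rewrite [RHS]dprodDE !prjE PE.
by case QS: (Q _); rewrite /= ?(extension_disj QS) ?addr0 ?add0r.
Qed.

Lemma prjR_ext p b (x : fm p b) : prj R p b (prj P p b x) = prj R p b x.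
Proof.
by case: ePQR => _ PE _; apply/ffunP => S; rewrite !prjE PE orbC; case: (R _).
Qed.

Lemma prjQR p b (x : fm p b) : prj Q p b (prj R p b x) = 0.
Proof.
apply/ffunP => S; rewrite !prjE [RHS]dprod0E.
by case QS: (Q _) => //; rewrite extension_disj.
Qed.

Lemma prjRQ p b (x : fm p b) : prj R p b (prj Q p b x) = 0.
Proof.
apply/ffunP => S; rewrite !prjE [RHS]dprod0E.
by case QS: (Q _); [rewrite extension_disj | case: (R _)].
Qed.

Lemma dblk_ext p q b (x : fm p b) : dblk P P p q b x =
  dblk Q Q p q b x + (dblk Q R p q b x + dblk R R p q b x).
Proof.
have := dblk_RQ q x; rewrite !dblkE !prj_ext !linearD /= => ->.
by rewrite addr0.
Qed.

Lemma prjQ_dblk p q b (x : fm p b) : prj Q q b (dblk P P p q b x) = dblk Q Q p q b x.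
Proof.
rewrite dblk_ext -(prj_dblk Q R) -(prj_dblk R R) !linearD /= !prjQR !addr0.
exact: prj_id.
Qed.

Lemma prjR_dblk p q b (x : fm p b) :
  prj R q b (dblk P P p q b x) = dblk Q R p q b x + dblk R R p q b x.
Proof.
rewrite dblk_ext -(prj_dblk Q Q) !linearD /= prjRQ add0r.
by congr (_ + _); exact: prj_id.
Qed.

Lemma dblk_extR p q b (x : fm p b) :
  prj R p b x = x -> dblk P P p q b x = dblk R R p q b x.
Proof.
move=> <-; rewrite dblk_ext -(dblk_prj Q Q) -(dblk_prj Q R) prjQR !linear0.
by rewrite !add0r.
Qed.

Lemma prjP_subR p b (x : fm p b) : prj R p b x = x -> prj P p b x = x.
Proof. by move=> <-; rewrite prj_ext prjQR add0r prj_id. Qed.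

Lemma prjP_subQ p b (x : fm p b) : prj Q p b x = x -> prj P p b x = x.
Proof. by move=> <-; rewrite prj_ext prjRQ addr0 prj_id. Qed.

Lemma dblk_extQ p q b (x : fm p b) : prj Q p b x = x ->
  dblk P P p q b x = dblk Q Q p q b x + dblk Q R p q b x.
Proof.
by move=> <-; rewrite dblk_ext -(dblk_prj R R) prjRQ linear0 addr0.
Qed.

(** A primitive of the [Q]-component of a cycle is lifted to [P]; subtracting its differential
    leaves a cycle in the subcomplex [R]. *)
Lemma exact_on_ext b : exact_on Q b -> exact_on R b -> exact_on P b.
Proof.
have [cP _ _] := ePQR; move=> exQ exR p q r eq er x xP dx.
have [||y dy] := exQ p q r eq er (prj Q q b x); first exact: prj_id.
  by rewrite dblk_prj -prjQ_dblk dx linear0.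
pose z := x - dblk P P p q b (prj Q p b y).
have zQ : prj Q q b z = 0 by rewrite linearB /= prjQ_dblk dblk_prj dy subrr.
have zR : prj R q b z = z.
  have <- : prj P q b z = z by rewrite linearB /= xP prj_dblk.
  by rewrite [RHS]prj_ext zQ add0r prjR_ext.
have [|w dw] := exR p q r eq er z zR.
  by rewrite -dblk_extR // linearB /= dx dblk_dblk // subrr.
exists (prj Q p b y + prj R p b w).
by rewrite linearD /= [X in _ + X]dblk_extR ?prj_id // dblk_prj dw addrC subrK.
Qed.

(** The difference of [x] and the [R]-part of [w] is a cycle of [P], and a primitive of it also
    bounds [x] in the quotient [Q]. The primed indices absorb the shifts in the corner map. *)
Lemma connecting_inj b p q r q' r' (x : fm q b) (w : fm q' b) :
  q = p + 1 -> r = q + 1 -> q' = q -> r' = q + 1 ->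
  exact_on P b -> prj Q q b x = x -> dblk Q Q q r b x = 0 ->
  dblk Q R q r' b x = dblk R R q' r' b w ->
  exists u : fm p b, dblk Q Q p q b u = x.
Proof.
move=> eq er eq' er' exP; rewrite {}er' -er; rewrite {}eq' in w *.
move=> xQ dQx dx; have [||u du] := exP p q r eq er (x - prj R q b w).
- by rewrite linearB /= prjP_subQ // prjP_subR ?prj_id.
- rewrite linearB /= dblk_extQ // dblk_extR ?prj_id // dblk_prj dQx add0r.
  by rewrite dx subrr.
by exists u; rewrite -prjQ_dblk du linearB /= prjQR subr0.
Qed.

Lemma connecting_surj b p q r p' q' (y : fm q b) :
  q = p + 1 -> r = q + 1 -> p' = p -> q' = p + 1 ->
  exact_on P b -> prj R q b y = y -> dblk R R q r b y = 0 ->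
  exists (u : fm p b) (w : fm p' b), dblk Q Q p q' b u = 0 /\
    y = dblk Q R p q b u + dblk R R p' q b w.
Proof.
move=> eq er ep' eq' exP yR dy; rewrite {}ep' {}eq' -eq.
have [||u du] := exP p q r eq er y; first exact: prjP_subR.
  by rewrite dblk_extR.
(* One primitive serves twice: the block from [Q] reads only its [Q]-part, the block from [R] only
   its [R]-part. *)
exists u, u; rewrite -prjQ_dblk -prjR_dblk du yR; split=> //.
by rewrite -yR prjQR.
Qed.

(** The connecting image of a cycle of [Q] is a cycle of [R], hence a boundary, and [connecting_inj]
    applies. *)
Lemma exact_on_quo b : exact_on P b -> exact_on R b -> exact_on Q b.
Proof.
have [cP _ _] := ePQR; move=> exP exR p q r eq er x xQ dx.
have [||w dw] := exR q r (r + 1) er erefl (dblk Q R q r b x).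
- exact: prj_dblk.
- rewrite -dblk_extR ?prj_dblk // -[dblk Q R q r b x]add0r -dx.
  by rewrite -dblk_extQ // dblk_dblk.
exact: (connecting_inj eq er erefl er exP xQ dx (esym dw)).
Qed.

End Extension.

(** * Slicing regions into strands *)

Definition vars (J : {set 'I_t}) : {set var n} := [set x | tag x \in J].

Lemma wt_vars J i : i \in J -> wt (vars J) i = (n i).+1%:Z.
Proof.
move=> iJ; rewrite ffunE; congr (_%:Z).
pose f (y : 'I_(n i).+1) : var n := Tagged (fun i => 'I_(n i).+1) y.
transitivity #|codom f|; last first.
  rewrite card_codom ?card_ord // => y z e; apply/eqP.
  by have <- := @eq_Tagged _ (fun i => 'I_(n i).+1) (f y) z; apply/eqP.
apply: eq_card => x; rewrite !inE; apply/andP/codomP => [[_ /eqP e]|[y ->]] //.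
by case: x e => j y /= e; case: _ / e @f; exists y.
Qed.

Lemma wt_setI_vars J (S : {set var n}) i : i \in J -> wt (S :&: vars J) i = wt S i.
Proof.
move=> iJ; rewrite !ffunE; congr (_%:Z); apply: eq_card => x; rewrite !inE.
by case: eqP => [->|]; rewrite ?iJ ?andbT ?andbF.
Qed.

Lemma wt_le S i : 0 <= wt S i <= (n i).+1%:Z.
Proof.
have iJ : i \in [set i] by rewrite set11.
rewrite -(wt_vars iJ) -(wt_setI_vars S iJ).
by rewrite (forallP (wt_sub (subsetIr _ _)) i) ffunE lez_nat.
Qed.

(** Slices are attached in increasing order of [a i]: the new slice is the subcomplex, the part
    already treated the quotient. Only [n i + 2] values of [a i] contribute in degree [b], so the
    process ends. *)
Lemma slices_exact_on P (i : 'I_t) b : convex P ->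
  (forall e, exact_on (fun a => P a && (a i == e)) b) -> exact_on P b.
Proof.
move=> cP exP; pose lo : int := b i - (n i).+1%:Z.
have boxE (S : {set var n}) : lo <= (b - wt S) i < lo + (n i).+2%:Z.
  have /andP[w0 wn] := wt_le S i; rewrite /lo !ffunE.
  rewrite ffunE in w0 wn; rewrite lerD2l lerN2 wn -addrA ltrD2l -[(n i).+2]addn1.
  by rewrite PoszD addKr (le_lt_trans _ ltr01) // oppr_le0.
have cut m : exact_on (fun a => P a && (a i < lo + m%:Z)) b.
  elim: m => [|m IHm].
    apply: exact_on_pred0 => S; have /andP[+ _] := boxE S.
    by rewrite addr0 leNgt => /negPf ->; rewrite andbF.
  apply: exact_on_ext IHm (exP (lo + m%:Z)); split.
  - move=> a a' a'' /andP[Pa _] /andP[Pa'' lt] le1 le2.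
    rewrite (cP _ _ _ Pa Pa'' le1 le2) /=.
    exact: le_lt_trans (forallP le2 i) lt.
  - move=> a; rewrite -andb_orr -addn1 PoszD addrA ltzD1 le_eqVlt.
    by rewrite orbC.
  - move=> a a'' /andP[_ /eqP ai] /andP[_ lt]; apply/negP => /forallP /(_ i).
    by rewrite ai leNgt lt.
apply: eq_exact_on (cut (n i).+2) => S.
by have /andP[_ ->] := boxE S; rewrite andbT.
Qed.

Lemma coord_slices_exact_on P (s : seq 'I_t) b : uniq s -> convex P ->
  (forall c : Zt t, exact_on (fun a => P a && all (fun i => a i == c i) s) b) ->
  exact_on P b.
Proof.
elim: s P => [|i s IHs] P /=.
  by move=> _ _ exP; apply: eq_exact_on (exP 0) => S; rewrite andbT.
move=> /andP[iNs us] cP exP; apply: (slices_exact_on (i := i)) => // e.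
apply: IHs => // [a a' a''|c].
  move=> /andP[Pa /eqP ai] /andP[Pa'' /eqP ai''] le1 le2.
  rewrite (cP _ _ _ Pa Pa'' le1 le2) eq_le /=.
  by rewrite -{1}ai'' -{1}ai (forallP le1) (forallP le2).
pose c' : Zt t := [ffun j => if j == i then e else c j].
apply: eq_exact_on (exP c') => S; rewrite /= [c' i]ffunE eqxx -andbA.
congr [&& _, _ & _].
apply: eq_in_all => j js; rewrite [c' j]ffunE.
by have /negPf -> : j != i by apply: contraNneq iNs => <-.
Qed.

Lemma region_set0 c J (a : Zt t) :
  region c set0 J set0 a = [forall i in J, a i == c i].
Proof.
have e0 (p : pred 'I_t) : [forall i in set0, p i].
  by apply/forall_inP => i; rewrite inE.
by rewrite /region !e0 andbT.
Qed.

Lemma region_exact_on c I J L : exact (region_complex T c I J L) <->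
  forall b, exact_on (region c I J L) b.
Proof.
split=> [/exactE exP b | exP].
  by apply/(subquotient_exact_on (@region_convex _ c I J L)); exact: exP.
by apply/exactE => b; apply/(subquotient_exact_on (@region_convex _ c I J L)).
Qed.

(** Once all coordinates in [I :|: J :|: L] are fixed, the inequalities defining the region are
    decided: each slice is empty or a whole strand. *)
Lemma strands_exact_regions c I J L :
  (forall c', exact (strand T c' (I :|: J :|: L))) ->
  exact (region_complex T c I J L).
Proof.
set F := I :|: J :|: L => exS; apply/region_exact_on => b.
apply: (coord_slices_exact_on (s := enum F)); first exact: enum_uniq.
  exact: region_convex.
move=> c'.
have congr_region (a : Zt t) : all (fun i => a i == c' i) (enum F) ->
  region c I J L a = region c I J L c'.
  move=> /allP ac; rewrite /region.
  congr [&& _, _ & _]; apply: eq_forallb_in => i iI;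
    by rewrite (eqP (ac i _)) // mem_enum !inE iI ?orbT.
case Pc' : (region c I J L c'); last first.
  apply: exact_on_pred0 => S; apply/negP => /andP[Pa ac].
  by move: Pa; rewrite (congr_region _ ac) Pc'.
have /region_exact_on/(_ b) := exS c'; apply: eq_exact_on => S.
rewrite region_set0 /=; apply/forall_inP/andP => [aF|[_ /allP aF] i iF].
  have aF' : all (fun i => (b - wt S) i == c' i) (enum F).
    by apply/allP => i; rewrite mem_enum; exact: aF.
  by rewrite (congr_region _ aF').
by apply: aF; rewrite mem_enum.
Qed.

(** * Complexes whose generator degrees are constant on [J] *)

Lemma act_monE (B : Zt t -> lmodType K) b c (f : free_mod n B b) (A S : {set var n}) :
  act (free_mod n B) c f (emon K A) S =
  if [disjoint A & S] then
    (-1) ^+ inversions A S *: gcast (c - wt S) (f (A :|: S)) else 0.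
Proof.
rewrite [LHS]ffunE; under eq_bigr do rewrite emon_mul /emonM.
case: ifP => dAS; last by rewrite big1 // => U _; rewrite ffunE scale0r.
rewrite (bigD1 (A :|: S)) //= big1 => [|U /negPf UAS]; rewrite !ffunE ?eqxx ?UAS.
  by rewrite [_ *: 1]mulr1 addr0.
by rewrite [_ *: 0]mulr0 scale0r.
Qed.

Lemma sub_wt_eq (A S : {set var n}) J : A \subset S -> S \subset vars J ->
  (forall i, i \in J -> wt A i = wt S i) -> A = S.
Proof.
move=> sAS SJ wtAS; apply/eqP; rewrite eqEsubset sAS /=; apply/subsetP => x xS.
have := wtAS (tag x); have /[!inE] xJ := subsetP SJ x xS.
rewrite !ffunE => /(_ xJ) [] e.
have : [set y in A | tag y == tag x] = [set y in S | tag y == tag x].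
  apply/eqP; rewrite eqEcard e leqnn andbT; apply/subsetP => y; rewrite !inE.
  by case/andP=> /(subsetP sAS) -> ->.
by move/setP/(_ x); rewrite !inE xS eqxx andbT.
Qed.

(* With generator degrees fixed on [J], the component of [z] along the monomial [A] of
   the exterior algebra on the variables in [J]. *)
Definition trace J A p b (z : fm p b) : fm p b :=
  [ffun S => if S :&: vars J == A then z S else 0].

Section Shape.
Variables (P : pred (Zt t)) (c : Zt t) (J : {set 'I_t}).
Hypothesis PJ : forall a : Zt t, P a -> forall i, i \in J -> a i = c i.

Lemma wt_shape b (S : {set var n}) i : P (b - wt S) -> i \in J -> wt S i = b i - c i.
Proof. by move=> PS iJ; rewrite -(PJ PS iJ) !ffunE opprB addrCA subrr addr0. Qed.

(** Both monomials have weight [b i - c i] at each [i] in [J], so their nested parts in [vars J]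
    coincide. This is why the differential preserves the part of a monomial in [vars J]. *)
Lemma trace_shape b (S U : {set var n}) : S \subset U ->
  P (b - wt S) -> P (b - wt U) -> S :&: vars J = U :&: vars J.
Proof.
move=> SU PS PU; apply: (@sub_wt_eq _ _ J); [exact: setSI | exact: subsetIr |].
by move=> i iJ; rewrite !wt_setI_vars // (wt_shape PS) // (wt_shape PU).
Qed.

Lemma dblk_trace A p q b (z : fm p b) :
  dblk P P p q b (trace J A z) = trace J A (dblk P P p q b z).
Proof.
apply/ffunP => S; rewrite [RHS]ffunE !dblkE !prjE.
case PS: (P _); last by rewrite if_same.
case: eqP => [SA|nSA]; last first.
  apply: ghom_free_support => U SU; rewrite prjE ffunE.
  case PU: (P _) => //; case: eqP => // UA; case: nSA.
  by rewrite (trace_shape SU PS PU).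
apply/eqP; rewrite -subr_eq0 -dprodBE -linearB; apply/eqP.
apply: ghom_free_support => U SU; rewrite dprodBE !prjE ffunE.
case PU: (P _); last by rewrite subrr.
by rewrite -(trace_shape SU PS PU) SA eqxx subrr.
Qed.

Lemma exact_trace b A p q r (z : fm q b) :
  (forall b' : Zt t,
     (forall i, i \in J -> b' i = c i + (n i).+1%:Z) -> exact_on P b') ->
  q = p + 1 -> r = q + 1 -> trace J A z = z ->
  prj P q b z = z -> dblk P P q r b z = 0 -> exists y : fm p b, dblk P P p q b y = z.
Proof.
move=> exP eq er zA zP dz.
have suppz S : z S <> 0 -> P (b - wt S) /\ S :&: vars J = A.
  rewrite -{1}zP prjE; case: (P _) => // zS; split=> //.
  by move: zS; rewrite -{1}zA ffunE; case: eqP.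
(* A nonzero coordinate is what shows that [A] has weight [b i - c i] at each [i] in [J]. *)
have [/existsP[S0 /eqP /suppz[PS0 S0A]] | z0] := boolP [exists S, z S != 0]; last first.
  exists 0; rewrite linear0; apply/esym/ffunP => S.
  by move: z0; rewrite negb_exists => /forallP/(_ S); rewrite negbK dprod0E => /eqP.
(* [z] is the product by [emon A'] of a cycle [l] in a degree [b'] where exactness
   is known. *)
pose A' := vars J :\: A; pose b' := b + wt A'.
have dA'S S : S :&: vars J = A -> [disjoint A' & S].
  move=> SA; rewrite -setI_eq0 -subset0; apply/subsetP => x.
  by rewrite /A' -SA !inE; case: (x \in S); rewrite ?andbF // !andbT andNb.
have b'E S : [disjoint A' & S] -> b' - wt (A' :|: S) = b - wt S.
  by move=> dA; rewrite wtU // /b' opprD addrA addrK.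
have b'J i : i \in J -> b' i = c i + (n i).+1%:Z.
  move=> iJ; rewrite -(wt_vars iJ).
  have -> : vars J = A' :|: S0 :&: vars J.
    by apply/setP => x; rewrite /A' -S0A !inE; case: (x \in S0); case: (_ \in J).
  have dA'A : [disjoint A' & A] by apply: dA'S; rewrite -S0A -setIA setIid.
  have addE (u v : Zt t) : (u + v) i = u i + v i by rewrite ffunE.
  have := wt_shape PS0 iJ; rewrite -(wt_setI_vars S0 iJ) S0A wtU // /b' !addE => ->.
  by rewrite addrCA [c i + _]addrC subrK addrC.
(* The sign is the one that the action of [emon A'] produces, so the two cancel and [l] is sent to
   [z]. *)
pose l : fm q b' := [ffun U : {set var n} => if A' \subset U then
  (-1) ^+ inversions A' (U :\: A') *: gcast (b' - wt U) (z (U :\: A')) else 0].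
have dDA' U : [disjoint A' & U :\: A'].
  by rewrite disjoint_sym disjoints_subset subsetDr.
have UE U : A' \subset U -> A' :|: U :\: A' = U.
  move=> /subsetP A'U; apply/setP => x; rewrite in_setU in_setD.
  by case: (boolP (x \in A')) => [/A'U ->|].
have lA' S : [disjoint A' & S] ->
    l (A' :|: S) = (-1) ^+ inversions A' S *: gcast (b' - wt (A' :|: S)) (z S).
  move=> dA; rewrite ffunE subsetUl.
  have -> : (A' :|: S) :\: A' = S; last by [].
  by rewrite setDUl setDv set0U; apply/setDidPl; rewrite disjoint_sym.
have actl : act (fm q) b l (emon K A') = z.
  apply/ffunP => S; rewrite act_monE; case: ifP => [dA|ndA]; last first.
    by apply/esym/eqP; apply: contraFT ndA => /eqP/suppz[_ /dA'S].
  rewrite lA' // linearZ /= scalerA -expr2 sqrr_sign scale1r gcast_comp ?gcast_id //.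
  by rewrite b'E.
have lP : prj P q b' l = l.
  apply/ffunP => U; rewrite prjE ffunE; case PU: (P _) => //.
  case: ifP => // A'U; suff -> : z (U :\: A') = 0 by rewrite linear0 scaler0.
  by apply/eqP; apply: contraFT PU => /eqP/suppz[+ _]; rewrite -b'E // UE.
(* In degree [b'] every monomial allowed by [P] contains [vars J], hence [A']. The action of
   [emon A'] therefore loses no coordinate, and [d z = 0] forces [d l = 0]. *)
have dl : dblk P P q r b' l = 0.
  apply/ffunP => U; rewrite -prj_dblk prjE [RHS]dprod0E; case PU: (P _) => //.
  have A'U : A' \subset U.
    apply: subset_trans (subsetDl _ _) _; apply/setIidPr.
    apply: (@sub_wt_eq _ _ J) => //; first exact: subsetIr.
    move=> i iJ; rewrite wt_setI_vars // (wt_shape PU) // b'J // wt_vars //.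
    by rewrite addrC addKr.
  have : act (fm r) b (dblk P P q r b' l) (emon K A') (U :\: A') = 0.
    by rewrite -hmap_act actl dz dprod0E.
  rewrite act_monE dDA' => /eqP; rewrite scaler_eq0 signr_eq0 /= => /eqP.
  move/(congr1 (gcast (b' - wt (A' :|: U :\: A')))).
  by rewrite gcast_comp ?b'E // gcast_id linear0 UE.
have [y dy] := exP b' b'J p q r eq er l lP dl.
by exists (act (fm p) b y (emon K A')); rewrite hmap_act dy.
Qed.

(** A cycle is the sum of its components [trace J A], which are cycles because [trace] commutes with
    the differential; each is bounded separately. *)
Lemma shape_exact_on b :
  (forall b' : Zt t,
     (forall i, i \in J -> b' i = c i + (n i).+1%:Z) -> exact_on P b') ->
  exact_on P b.
Proof.
move=> exP p q r eq er z zP dz.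
have /fin_all_exists[y dy] :
    forall A, exists y : fm p b, dblk P P p q b y = trace J A z.
  move=> A; apply: (exact_trace (A := A) exP eq er).
  - by apply/ffunP => S; rewrite !ffunE; case: (_ == A).
  - by apply/ffunP => S; rewrite prjE ffunE -{2}zP prjE; case: (P _); case: (_ == A).
  - rewrite dblk_trace dz; apply/ffunP => S; rewrite [LHS]ffunE [RHS]dprod0E.
    by rewrite dprod0E if_same.
exists (\sum_A y A); rewrite linear_sum; apply/ffunP => S.
transitivity ((\sum_A trace J A z) S); first by congr (fun_of_fin _ S); apply: eq_bigr.
rewrite (big_morph (fun f : fm q b => f S) (fun f g => dprodDE f g S) (dprod0E _ S)).
rewrite (bigD1 (S :&: vars J)) //= big1 => [|A /negPf SA].
  by rewrite ffunE eqxx addr0.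
by rewrite ffunE eq_sym SA.
Qed.

End Shape.

(** * Descent from large [c] to all [c], and back to strands *)

Lemma forall_in_set0 (p : pred 'I_t) : [forall i in set0, p i].
Proof. by apply/forall_inP => i; rewrite inE. Qed.

Lemma forall_in_setU1 j I (p : pred 'I_t) :
  [forall i in j |: I, p i] = p j && [forall i in I, p i].
Proof.
apply/forall_inP/andP => [pjI|[pj /forall_inP pI] i].
  split; first by apply: pjI; rewrite setU11.
  by apply/forall_inP => i iI; apply: pjI; rewrite setU1r.
by rewrite in_setU1 => /predU1P[-> | /pI].
Qed.

Lemma region_lt c I (a : Zt t) : region c I set0 set0 a = [forall i in I, a i < c i].
Proof. by rewrite /region !forall_in_set0 !andbT. Qed.

Definition bump_at c (i : 'I_t) (m : int) : Zt t :=
  [ffun j => if j == i then c j + m else c j].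

(** For [i] in [I], the region at [c] is the quotient of the region at [c + e_i] by its slice
    [a i = c i], so it suffices that this slice be exact. *)
Lemma region_lt_pred I c i :
  (forall b, exact_on (region (bump_at c i 1) I set0 set0) b) ->
  forall b, exact_on (region c I set0 set0) b.
Proof.
set P := region (bump_at c i 1) I set0 set0 => exP b.
have [iI | niI] := boolP (i \in I); last first.
  apply: eq_exact_on (exP b) => S; rewrite /P !region_lt.
  apply: eq_forallb_in => j jI; rewrite [bump_at c i 1 j]ffunE.
  by have /negPf -> : j != i by apply: contraNneq niI => <-.
pose R := [pred a : Zt t | P a & a i == c i].
have RJ (a : Zt t) : R a -> forall j, j \in [set i] -> a j = c j.
  by move=> /andP[_ /eqP aci] j /set1P ->.
apply: (@exact_on_quo P _ R) (exP b) _.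
  split; first exact: region_convex.
  - move=> a; rewrite /R /= /P !region_lt -(setD1K iI) !forall_in_setU1 ffunE eqxx.
    have -> : [forall j in I :\ i, a j < bump_at c i 1 j] =
              [forall j in I :\ i, a j < c j].
      by apply: eq_forallb_in => j /setD1P[/negPf ji _]; rewrite ffunE ji.
    by rewrite ltzD1 le_eqVlt; case: (_ == _); case: (_ < _); case: [forall j, _].
  - move=> a a'' /andP[_ /eqP ai]; rewrite region_lt => /forall_inP/(_ i iI) a''i.
    by apply/negP => /forallP/(_ i); rewrite ai leNgt a''i.
(* Since [b' i = c i + n i + 1], every contributing degree has [a i >= c i]; with [a i < c i + 1]
   from [P], the slice is all of [P]. *)
apply: (shape_exact_on RJ) => b' b'i; apply: eq_exact_on (exP b') => S.
rewrite /R /=; case PS: (P _) => //=; symmetry.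
move: PS; rewrite /P region_lt => /forall_inP/(_ i iI).
rewrite [bump_at _ _ _ _]ffunE eqxx.
rewrite ltzD1 eq_le => -> /=.
have /andP[_ wS] := wt_le S i; rewrite ffunE in wS.
by rewrite !ffunE b'i ?set11 // -addrA lerDl subr_ge0.
Qed.

Lemma region_lt_all I (c0 : Zt t) :
  (forall c, led c0 c -> exact (region_complex T c I set0 set0)) ->
  forall c b, exact_on (region c I set0 set0) b.
Proof.
move=> exI; have bump m c i :
    (forall b, exact_on (region (bump_at c i m%:Z) I set0 set0) b) ->
    forall b, exact_on (region c I set0 set0) b.
  elim: m c => [|m IHm] c exc.
    have -> // : c = bump_at c i 0.
    by apply/ffunP => j; rewrite ffunE addr0 if_same.
  apply: IHm; apply: (@region_lt_pred _ _ i) => b.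
  have -> // : bump_at (bump_at c i m) i 1 = bump_at c i m.+1.
  by apply/ffunP => j; rewrite !ffunE; case: eqP => //; rewrite -addrA -PoszD addn1.
(* [s] lists the coordinates in which [c] may lie below [c0]; each is raised by [|c0 i - c i|] and
   then brought back down by [bump]. *)
have step (s : seq 'I_t) c : (forall i, i \notin s -> c0 i <= c i) ->
    forall b, exact_on (region c I set0 set0) b.
  elim: s c => [|i s IHs] c le.
    by apply/region_exact_on/exI/forallP => i; exact: le.
  apply: (bump `|c0 i - c i|%N c i); apply: IHs => j js; rewrite ffunE.
  case: eqP => [->|/eqP ji]; last by apply: le; rewrite inE negb_or ji.
  by rewrite -lerBlDl abszE ler_norm.
by move=> c; apply: (step (enum 'I_t)) => i; rewrite mem_enum.
Qed.

Lemma regions_exact_strand c J :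
  (forall c b, exact_on (region c J set0 set0) b) -> exact (strand T c J).
Proof.
move=> exJ; apply/region_exact_on => b; apply: (@shape_exact_on _ c J) => [a|b' b'J].
  by rewrite region_set0 => /forall_inP aJ i /aJ/eqP.
(* In degree [b'] only [a i >= c i] occurs for [i] in [J], so [a i < c i + 1] means [a i = c i]. *)
pose c1 : Zt t := [ffun i => c i + 1].
apply: eq_exact_on (exJ c1 b') => S; rewrite region_lt region_set0.
apply: eq_forallb_in => i iJ; rewrite [c1 i]ffunE ltzD1 eq_le; symmetry.
have /andP[_ wS] := wt_le S i; rewrite ffunE in wS.
by rewrite !ffunE b'J // -addrA lerDl subr_ge0 wS andbT.
Qed.

(** * Corner maps as composites of quasi-isomorphisms *)

Lemma corner_extension c k : (k < t)%N ->
  extension (region c (initial t k) set0 [set i : 'I_t | (k < i)%N])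
    (qregion c (initial t k.+1)) (qregion c (initial t k)).
Proof.
move=> kt; pose k' := Ordinal kt.
have i1 : initial t k.+1 = k' |: initial t k.
  by apply/setP => i; rewrite !inE ltnS leq_eqVlt.
have i2 : ~: initial t k = k' |: [set i : 'I_t | (k < i)%N].
  by apply/setP => i; rewrite !inE -leqNgt leq_eqVlt eq_sym.
have i3 : ~: initial t k.+1 = [set i : 'I_t | (k < i)%N].
  by apply/setP => i; rewrite !inE -leqNgt.
split; first exact: region_convex.
  move=> a; rewrite /qregion /region i3 i2 i1 !forall_in_setU1 forall_in_set0 /=.
  rewrite leNgt; case: (a k' < _); case: [forall i in initial t k, _] => //=.
  by rewrite orbF.
move=> a a''; rewrite /qregion /region i1 i2 !forall_in_setU1.
move=> /and3P[_ _ /andP[ca _]] /andP[/andP[ac _] _]; apply/negP => /forallP/(_ k').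
by move/(le_trans ca); rewrite leNgt ac.
Qed.

Lemma corner_step_qis c k : (k < t)%N ->
  exact (region_complex T c (initial t k) set0 [set i : 'I_t | (k < i)%N]) ->
  qis (corner_step T c k).
Proof.
move=> kt /region_exact_on exP p q r b eq er.
have ext := corner_extension c kt.
set Q := qregion c _ in ext; set R := qregion c _ in ext.
(* The extra shift of the source by one makes the connecting block, of degree one in [T], a map of
   degree zero. *)
have ix (m m' : int) : m' = m + 1 -> - k.+1%:Z + m' = - k%:Z + m.
  by move=> ->; rewrite -addn1 PoszD opprD addrACA addNr addr0.
have ix1 (u m m' : int) : m' = m + 1 -> u + m' = u + m + 1 by move=> ->; rewrite addrA.
split=> [x v dx fx | y dy].
  (* This absorbs the sign of the differential of the shifted target. *)
  pose v' := (-1) ^ (- k%:Z) *: v.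
  have [|||||||u du] := @connecting_inj _ _ _ ext b (- k.+1%:Z + p) (- k.+1%:Z + q)
      (- k.+1%:Z + r) (- k%:Z + p) (- k%:Z + q)
      (region_in n Q _ b x) (region_in n R _ b v') _ _ _ _ (exP b).
  - exact: ix1.
  - exact: ix1.
  - by rewrite (ix _ _ eq).
  - by rewrite -(ix _ _ er); exact: ix1.
  - exact: prj_region_in.
  - have /diff_shift_eq0 dx' := dx.
    by rewrite -region_in_blk [blk _ _ _ _ _ _ _]dx' linear0.
  - rewrite -!region_in_blk; congr (region_in n R _ b _).
    by rewrite [LHS]fx /v' linearZ.
  exists (((-1) ^ (- k.+1%:Z))^-1 *: region_out n Q _ b u).
  rewrite diff_shift linearZ /= scalerA mulfV ?signz_neq0 // scale1r.
  by rewrite -[LHS]region_out_dblk du region_out_in.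
have [||||||u [w [du yE]]] := @connecting_surj _ _ _ ext b (- k.+1%:Z + q) (- k%:Z + q)
    (- k%:Z + r) (- k%:Z + p) (- k.+1%:Z + r) (region_in n R _ b y) _ _ _ _ (exP b).
- by rewrite (ix _ _ eq); exact: ix1.
- exact: ix1.
- by rewrite (ix _ _ eq).
- exact: ix1.
- exact: prj_region_in.
- have /diff_shift_eq0 dy' := dy.
  by rewrite -region_in_blk [blk _ _ _ _ _ _ _]dy' linear0.
exists (region_out n Q _ b u), (((-1) ^ (- k%:Z))^-1 *: region_out n R _ b w); split.
  by apply/diff_shift_eq0; rewrite -[LHS]region_out_dblk du linear0.
rewrite diff_shift linearZ /= scalerA mulfV ?signz_neq0 // scale1r.
rewrite -[y]region_out_in yE linearD; congr (_ + _); exact: region_out_dblk.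
Qed.

Lemma corner_exact c :
  (forall k, (k < t)%N ->
     exact (region_complex T c (initial t k) set0 [set i : 'I_t | (k < i)%N])) ->
  exact (corner T c).
Proof.
move=> exT; apply: qis_cone_exact.
suff qk k : (k <= t)%N -> qis (corner_iter T c k) by exact: qk.
elim: k => [|k IHk] kt; first exact: qis_shift0.
apply: qis_comp; first by apply: IHk; exact: ltnW.
by apply: corner_step_qis => //; exact: exT.
Qed.

(** * From corner complexes to proper regions *)

Lemma restr_eq0 P p b (x : free_mod n (restr P (gens T p)) b) :
  (forall S, ~~ P (b - wt S)) -> x = 0.
Proof. by move=> P0; apply/ffunP => S; rewrite dprod0E; apply: restr0. Qed.

Lemma exact_region_of_corners c0 I : I \proper setT ->
  (forall c, led c0 c -> exact (corner T c)) ->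
  forall c, led c0 c -> exact (region_complex T c I set0 set0).
Proof.
move=> /properP[_ [i0 _ i0I]] exC c c0c; apply/region_exact_on => b.
(* [c'] depends on [b]: outside [I] it exceeds [b i], an upper bound for the contributing [a i], and
   the maximum keeps it above [c0]. *)
pose c' : Zt t := [ffun i => if i \in I then c i else Num.max (c i) (b i + 1)].
have /exC/exactE/(_ b) : led c0 c'.
  apply/forallP => i; rewrite ffunE; case: (i \in I); first exact: (forallP c0c).
  by rewrite le_max (forallP c0c).
move=> /cone_exact_at exA.
have boxb S i : (b - wt S) i <= b i.
  by have /andP[w0 _] := wt_le S i; rewrite ffunE in w0; rewrite !ffunE gerDl oppr_le0.
have /exact_at_shift/subquotient_exact_on exT : exact_at (shift (- t%:Z) (T_lt T c')) b.
  (* [T_ge] vanishes in degree [b] because of the coordinate [i0] outside [I]. *)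
  apply: exA => p y; apply: restr_eq0 => S; apply/negP.
  move=> /and3P[_ _ /forall_inP/(_ i0)].
  rewrite !inE ffunE (negPf i0I) => /(_ isT); rewrite ge_max => /andP[_].
  by rewrite leNgt ltzD1 boxb.
apply: eq_exact_on exT => S.
rewrite /qregion initialt setCT region_lt /region !forall_in_set0.
rewrite !andbT; apply/forall_inP/forall_inP => lt i iI.
  by have := lt i; rewrite inE [c' i]ffunE iI; exact.
rewrite [c' i]ffunE; case: ifP => [/lt // | _].
by rewrite lt_max ltzD1 boxb orbT.
Qed.

End Blocks.

Theorem theorem3p3 (K : fieldType) (t : nat) (n : 'I_t -> nat)
    (T : free_complex K n) (T_locally_finite : locally_finite T) :
  [<->
    (* 1 *) forall (c : Zt t) (J : {set 'I_t}),
              J \proper [set: 'I_t] -> exact (strand T c J);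
    (* 2 *) forall (c : Zt t) (I J L : {set 'I_t}),
              [disjoint I & J] -> [disjoint I & L] -> [disjoint J & L] ->
              I :|: J :|: L != [set: 'I_t] -> exact (region_complex T c I J L);
    (* 3 *) forall c : Zt t, exact (corner T c);
    (* 4 *) exists c0 : Zt t, forall c : Zt t, led c0 c -> exact (corner T c);
    (* 5 *) exists c0 : Zt t, forall c : Zt t, led c0 c ->
              forall I : {set 'I_t}, I \proper [set: 'I_t] ->
              exact (region_complex T c I set0 set0)].
Proof.
tfae.
- move=> exS c I J L _ _ _ IJL; apply: strands_exact_regions => c'.
  by apply: exS; rewrite properT.
- move=> exR c; apply: corner_exact => k kt; apply: exR.
  + by rewrite -setI_eq0 setI0.
  + rewrite -setI_eq0; apply/eqP/setP => i; rewrite !inE.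
    by case: ltngtP.
  + by rewrite -setI_eq0 set0I.
  + apply/eqP => /setP/(_ (Ordinal kt)).
    by rewrite !inE /= ltnn.
- by move=> exC; exists 0 => c _; exact: exC.
- move=> [c0 exC]; exists c0 => c c0c I I_proper.
  exact: (exact_region_of_corners I_proper exC).
- move=> [c0 exI] c J J_proper; apply: regions_exact_strand.
  by apply: (@region_lt_all _ _ _ _ _ c0) => c' c0c'; exact: exI.
Qed.
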